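(* Let $k\ge 2$ and let $G$ be a connected $k$-uniform hypergraph with $n$ vertices and $m\ge 1$ edges, let $\rho(G)$ be its spectral radius, and let $x=(x_1,\dots,x_n)^{\mathrm T}$ be the principal eigenvector of $G$, with maximum entry $x_{\max}$. Then $$x_{\max}\ge\left(\frac{\rho(G)}{km}\right)^{\frac1k},$$ with equality if and only if $G$ is regular.
   Context: A $k$-uniform hypergraph $G$ has a finite vertex set $V(G)=\{1,\dots,n\}$ and a set $E(G)$ of edges, each of which is a set of exactly $k$ distinct vertices. The degree $d_i$ of a vertex $i$ is the number of edges containing $i$; $G$ is regular if all vertices have the same degree. A path from $u$ to $v$ is an alternating sequence $v_0e_1v_1e_2\cdots v_{l-1}e_lv_l$ with $v_0=u$, $v_l=v$, where the vertices $v_0,\dots,v_l$ are distinct, the edges $e_1,\dots,e_l$ are distinct, and $v_{i-1},v_i\in e_i$ for $i=1,\dots,l$; $G$ is connected if there is a path between any two vertices. The adjacency tensor of $G$ is $\mathcal{A}_G=(a_{i_1\cdots i_k})$, of order $k$ and dimension $n$, with $a_{i_1\cdots i_k}=\frac{1}{(k-1)!}$ if $\{i_1,\dots,i_k\}\in E(G)$ and $a_{i_1\cdots i_k}=0$ otherwise. For $x\in\mathbb{C}^n$, $\mathcal{A}_Gx^{k-1}\in\mathbb{C}^n$ has $i$-th component $\sum_{i_2,\dots,i_k=1}^n a_{ii_2\cdots i_k}x_{i_2}\cdots x_{i_k}$. A number $\lambda\in\mathbb{C}$ is an eigenvalue of $\mathcal{A}_G$ with eigenvector $x\in\mathbb{C}^n\setminus\{0\}$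 if $\mathcal{A}_Gx^{k-1}=\lambda x^{[k-1]}$, where $x^{[k-1]}=(x_1^{k-1},\dots,x_n^{k-1})^{\mathrm T}$. The spectral radius $\rho(G)$ is the maximum modulus of the eigenvalues of $\mathcal{A}_G$. For $G$ connected, by the Perron–Frobenius theorem for nonnegative weakly irreducible tensors, $\rho(G)$ is an eigenvalue and there is a unique eigenvector $x=(x_1,\dots,x_n)^{\mathrm T}$ for $\rho(G)$ with all entries positive and $\sum_{i=1}^n x_i^k=1$; it is called the principal eigenvector of $G$. Write $x_{\max}=\max_i x_i$. *)

(* Defs.v *)
From HB Require Import structures.
From mathcomp Require Import all_boot all_order all_algebra.
From mathcomp Require Import complex reals exp.
Set Implicit Arguments.
Unset Strict Implicit.
Unset Printing Implicit Defensive.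
Import Order.TTheory GRing.Theory Num.Theory.
Local Open Scope ring_scope.
Local Open Scope complex_scope.

Record hypergraph (n k : nat) := Hypergraph {
  edges : {set {set 'I_n}};
  edges_uniform : forall e, e \in edges -> #|e| = k }.

Definition degree n k (G : hypergraph n k) (i : 'I_n) : nat :=
  #|[set e in edges G | i \in e]|.

Definition regular n k (G : hypergraph n k) : Prop :=
  forall i j : 'I_n, degree G i = degree G j.

(* The alternating sequence v_0 e_1 v_1 ... e_l v_l is encoded by its first
   vertex v_0 and the list [:: (e_1, v_1); ...; (e_l, v_l)]. *)
Fixpoint hwalk n k (G : hypergraph n k) (u : 'I_n)
    (p : seq ({set 'I_n} * 'I_n)) (v : 'I_n) : bool :=
  if p is (e, w) :: p' then
    [&& e \in edges G, u \in e, w \in e & hwalk G w p' v]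
  else u == v.

Definition hpath n k (G : hypergraph n k) (u : 'I_n)
    (p : seq ({set 'I_n} * 'I_n)) (v : 'I_n) : bool :=
  [&& hwalk G u p v, uniq (u :: unzip2 p) & uniq (unzip1 p)].

Definition hconnected n k (G : hypergraph n k) : Prop :=
  forall u v : 'I_n, exists p, hpath G u p v.

Definition tensor (F : Type) (k n : nat) := k.-tuple 'I_n -> F.

(* A tuple with a repeated index spans a set of fewer than k vertices, hence
   never an edge, so its entry is 0. *)
Definition adjacency_tensor (F : fieldType) n k (G : hypergraph n k) :
    tensor F k n :=
  fun t => if [set:: t] \in edges G then ((k.-1)`!)%:R^-1 else 0.

(* The i-th component of A x^(k-1): the sum ranges over the index tuples
   (i_1, ..., i_k) with i_1 = i, and the monomial is x_(i_2) ... x_(i_k). *)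
Definition tensor_apply (F : fieldType) k n (A : tensor F k n) (x : 'cV[F]_n) :
    'cV[F]_n :=
  \col_i \sum_(t : k.-tuple 'I_n | ohead t == Some i)
           A t * \prod_(j <- behead t) x j 0.

Definition tensor_eigenpair (F : fieldType) k n (A : tensor F k n)
    (lambda : F) (x : 'cV[F]_n) : Prop :=
  x != 0 /\ tensor_apply A x = \col_i (lambda * x i 0 ^+ k.-1).

Definition tensor_eigenvalue (F : fieldType) k n (A : tensor F k n) (lambda : F) :
    Prop :=
  exists x : 'cV[F]_n, tensor_eigenpair A lambda x.

(* `|lambda| : R[i] is the modulus, seen as a complex number. *)
Definition is_spectral_radius (R : realType) n k (G : hypergraph n k)
    (rho : R) : Prop :=
  (exists2 lambda : R[i],
     tensor_eigenvalue (adjacency_tensor R[i] G) lambda & `|lambda| = rho%:C) /\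
  (forall lambda : R[i],
     tensor_eigenvalue (adjacency_tensor R[i] G) lambda -> `|lambda| <= rho%:C).

Definition is_principal_eigenvector (R : realType) n k (G : hypergraph n k)
    (x : 'cV[R]_n) : Prop :=
  exists rho : R,
  [/\ is_spectral_radius G rho,
      tensor_eigenpair (adjacency_tensor R[i] G) rho%:C (map_mx (real_complex R) x),
      (forall i, 0 < x i 0) &
      \sum_(i < n) x i 0 ^+ k = 1].

(* The default value 0 is harmless when n > 0 and all entries are positive. *)
Definition max_entry (R : realType) n (x : 'cV[R]_n) : R :=
  \big[Num.max/0]_(i < n) x i 0.

(* Main.v *)
Require Import Defs.
From mathcomp Require Import all_boot all_order all_algebra.
From mathcomp Require Import complex reals exp.
Set Implicit Arguments.
Unset Strict Implicit.
Unset Printing Implicit Defensive.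
Import Order.TTheory GRing.Theory Num.Theory.
Local Open Scope ring_scope.

(** Write [x_A] for the product of the entries of [x] over a set [A] of vertices,
    [M] for the maximum entry and [m] for the number of edges; [e] ranges over
    the edges.

    Each edge through a vertex [i] is listed by exactly [(k-1)!] index tuples
    starting at [i], and this cancels the normalization of the adjacency tensor:
    the eigenvalue equation at [i] becomes
    [rho * x_i^(k-1) = \sum_(e | i in e) x_(e \ i)]
    ([tensor_apply_adjacency], [eigenpair_edge_equations]).
    Multiplying by [x_i] and summing over [i], each edge is counted once for
    each of its [k] vertices; since [\sum_i x_i^k = 1], this gives
    [rho = k * \sum_e x_e] ([edge_equations_total]).
    Each [x_e] is at most [M^k], hence [rho <= k * m * M^k], with equality
    exactly when every vertex lying on an edge has entry [M] ([leif_sum_prod]).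

    By connectedness every vertex lies on an edge, so equality forces [x] to be
    constant, and the eigenvalue equation then says that every degree is [rho].
    Conversely, if every degree is [d], the equation at a minimum of [x] gives
    [d <= rho].  At a maximum it then reads
    [d * M^(k-1) <= \sum_(e | i in e) x_(e \ i)], where the [d] terms on the
    right are at most [M^(k-1)]; so all the neighbours of a maximum are maxima
    ([regular_max_closed]).  Connectedness propagates this to all vertices
    ([connected_invariant]), and equality holds. *)

(** * From tensor entries to edges *)

(** A list that starts at [i], is as long as [e] and spans [e] cannot repeat an
    element; this makes the lists spanning [e] countable by
    [card_uniq_tuples]. *)
Lemma set_seq_cons_eq (T : finType) (e : {set T}) (i : T) (s : seq T) :
  i \in e -> #|e| = (size s).+1 ->
  ([set:: i :: s] == e) = all (mem (e :\ i)) s && uniq s.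
Proof.
move=> ie ce; apply/eqP/andP => [se | [/allP sub us]].
  have us : uniq (i :: s).
    by apply/card_uniqP; rewrite /= -ce -se cardsE.
  move: us => /= /andP[iNs us]; split=> //.
  apply/allP => j js; rewrite !inE -se !inE js orbT andbT.
  by apply: contraNneq iNs => <-.
have iNs : i \notin s by apply/negP => /sub; rewrite !inE eqxx.
apply/eqP; rewrite eqEcard; apply/andP; split.
  apply/subsetP => j; rewrite !inE => /predU1P[-> //|/sub].
  by rewrite !inE => /andP[].
by rewrite cardsE (card_uniqP _) /= ?ce // iNs.
Qed.

Lemma card_tuples_spanning (T : finType) k (e : {set T}) (i : T) :
  i \in e -> #|e| = k.+1 ->
  #|[set t : k.+1.-tuple T | (ohead t == Some i) && ([set:: t] == e)]| = k`!.
Proof.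
move=> ie ce.
pose S := [set s : k.-tuple T | all (mem (e :\ i)) s & uniq s].
have -> : [set t : k.+1.-tuple T | (ohead t == Some i) && ([set:: t] == e)]
          = [set cons_tuple i s | s in S].
  apply/setP => t; apply/idP/imsetP => [|[s]].
    rewrite inE; case: t => -[//|a s] st /= /andP[/eqP[->]].
    have ss : size s == k by [].
    rewrite set_seq_cons_eq ?(eqP ss) // => spanned.
    by exists (Tuple ss); [rewrite inE | exact: val_inj].
  move=> sS ->; move: sS.
  by rewrite !inE /= eqxx set_seq_cons_eq ?size_tuple.
rewrite card_imset; last first.
  by move=> s s' /(congr1 (@tval _ _)) [] /val_inj.
rewrite card_uniq_tuples.
have -> : #|mem (e :\ i)| = k.
  by move: ce; rewrite (cardsD1 i) ie => -[].
by rewrite ffactnn.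
Qed.

(** Grouping the index tuples by the set of vertices that they span leaves one
    monomial per edge, repeated [k!] times; the factor [1 / k!] of the
    adjacency tensor compensates for the repetition. *)
Lemma tensor_apply_adjacency (F : numFieldType) n k
    (G : hypergraph n k.+1) (x : 'cV[F]_n) (i : 'I_n) :
  tensor_apply (adjacency_tensor F G) x i 0 =
    \sum_(e in edges G | i \in e) \prod_(j in e :\ i) x j 0.
Proof.
rewrite mxE.
rewrite (partition_big (fun t : k.+1.-tuple 'I_n => [set:: t]) predT) //=.
rewrite [RHS]big_mkcond /=; apply: eq_bigr => e _.
case: ifPn => [/andP[eG ie]|eNG].
  have ce := edges_uniform eG.
  (* Each tuple in the block of [e] contributes the same amount. *)
  transitivity (\sum_(t : k.+1.-tuple 'I_n |
                      (ohead t == Some i) && ([set:: t] == e))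
                  ((k`!)%:R^-1 * \prod_(j in e :\ i) x j 0)).
    apply: eq_bigr => t /andP[ht /eqP se].
    rewrite /adjacency_tensor se eG /=; congr (_ * _).
    case: t ht se => -[//|a s] /= st /eqP[->] def_e; have /eqP := def_e.
    have ss : size s = k by move: st => /eqP[].
    rewrite set_seq_cons_eq ?ce ?ss // => /andP[/allP sub us].
    rewrite big_uniq //=; apply: eq_bigl => j; apply/idP/idP => [/sub //|].
    rewrite !inE -def_e inE => /andP[/negPf ji].
    by rewrite in_cons ji.
  rewrite sumr_const.
  have -> : #|[pred t : k.+1.-tuple 'I_n |
               (ohead t == Some i) && ([set:: t] == e)]| = k`!.
    by rewrite -(card_tuples_spanning ie ce) cardsE.
  rewrite -[LHS]mulr_natr mulrAC mulVf ?mul1r // pnatr_eq0 -lt0n.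
  exact: fact_gt0.
apply: big1 => t /andP[ht /eqP se].
rewrite /adjacency_tensor se; case: ifP => eG; last by rewrite mul0r.
case/negP: eNG; rewrite eG -se inE /=.
by case: t ht {se} => -[//|a s] /= _ /eqP[->]; rewrite mem_head.
Qed.

Definition edge_equations (R : realType) n k (G : hypergraph n k.+1) (rho : R)
    (x : 'cV[R]_n) : Prop :=
  forall i, rho * x i 0 ^+ k =
    \sum_(e in edges G | i \in e) \prod_(j in e :\ i) x j 0.

(** The eigenvalue equation is stated over the complex numbers, but all its terms
    are images of real numbers under an injective morphism. *)
Lemma eigenpair_edge_equations (R : realType) n k (G : hypergraph n k.+1)
    (rho : R) (x : 'cV[R]_n) :
  tensor_eigenpair (adjacency_tensor R[i] G) rho%:C%C
    (map_mx (real_complex R) x) ->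
  edge_equations G rho x.
Proof.
move=> [_ /colP eqC] i; have := eqC i.
rewrite tensor_apply_adjacency !mxE /= => {}eqC.
apply: (fmorph_inj (real_complex R)); rewrite rmorphM rmorphXn /= -eqC rmorph_sum.
apply: eq_bigr => e _; rewrite rmorph_prod.
by apply: eq_bigr => j _; rewrite mxE.
Qed.

Lemma spectral_radius_unique (R : realType) n k (G : hypergraph n k)
    (rho rho' : R) :
  is_spectral_radius G rho -> is_spectral_radius G rho' -> rho = rho'.
Proof.
move=> [[l ev nl] ub] [[l' ev' nl'] ub'].
apply/le_anti/andP; split; rewrite -lecR.
  by rewrite -nl ub'.
by rewrite -nl' ub.
Qed.

(** * Counting and connectedness *)

(** Double counting of the incident pairs of a vertex and an edge. *)
Lemma handshake (R : pzSemiRingType) n k (G : hypergraph n k)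
    (f : {set 'I_n} -> R) :
  \sum_(i < n) \sum_(e in edges G | i \in e) f e =
    (\sum_(e in edges G) f e) *+ k.
Proof.
rewrite (exchange_big_dep (mem (edges G))) /=; last by move=> i e _ /andP[].
rewrite -sumrMnl; apply: eq_bigr => e eG.
rewrite (eq_bigl (mem e)); last by move=> i; rewrite /= eG.
by rewrite sumr_const (edges_uniform eG).
Qed.

Lemma sumr_star_const n k (G : hypergraph n k) (R : pzSemiRingType) (i : 'I_n)
    (c : R) :
  \sum_(e in edges G | i \in e) c = c *+ degree G i.
Proof.
by rewrite sumr_const; congr (_ *+ _); apply: eq_card => e; rewrite !inE.
Qed.

(** Induction along the walk that underlies a path. *)
Lemma connected_invariant n k (G : hypergraph n k) (P : pred 'I_n) (u : 'I_n) :
  hconnected G ->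
  (forall e i j, e \in edges G -> i \in e -> j \in e -> P i -> P j) ->
  P u -> forall v, P v.
Proof.
move=> conn step Pu v; have [p /and3P[walk _ _]] := conn u v.
elim: p u walk Pu => [u /eqP <- //|[e w] p IHp u /and4P[eG ue we walk] Pu].
exact: IHp walk (step e u w eG ue we Pu).
Qed.

(** Lying on an edge is a property that spreads within each edge, and some vertex
    has it. *)
Lemma connected_covered n k (G : hypergraph n k) (i : 'I_n) :
  (2 <= k)%N -> hconnected G -> (1 <= #|edges G|)%N ->
  exists2 e, e \in edges G & i \in e.
Proof.
move=> k2 conn /card_gt0P[e eG].
pose P := [pred v | [exists e in edges G, v \in e]].
have ce := edges_uniform eG.
have /card_gt0P[u ue] : (0 < #|e|)%N by rewrite ce (leq_trans _ k2).
have Pu : P u by apply/existsP; exists e; rewrite eG.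
have /existsP[f /andP[fG fi]] : P i; last by exists f.
apply: (@connected_invariant _ _ _ P u conn _ Pu) => f a b fG _ bf _.
by apply/existsP; exists f; rewrite fG.
Qed.

(** * Bounding the products over edges *)

(** Since [M ^+ r] is nonzero, a product reaches it only if each factor is [M].
    The map [h] lets one statement serve both for whole edges, which gives the
    bound on the spectral radius, and for the edges through a vertex with that
    vertex removed, which gives the local argument in the regular case. *)
Lemma leif_sum_prod (R : numDomainType) (T : finType) (S : {set {set T}})
    (h : {set T} -> {set T}) (r : nat) (x : T -> R) (M : R) :
  (forall j, 0 < x j <= M) -> 0 < M ->
  (forall e, e \in S -> #|h e| = r) ->
  \sum_(e in S) \prod_(j in h e) x j <= M ^+ r *+ #|S|
    ?= iff [forall e in S, [forall j in h e, x j == M]].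
Proof.
move=> xM M0 ch; rewrite -sumr_const; apply: leif_sum => e eS.
have := @leif_pprod R T (mem (h e)) (fun j => x j == M) x (fun=> M).
rewrite /= prodr_const (ch e eS) expf_eq0 (gt_eqF M0) andbF orFb; apply.
  by move=> j _; case/andP: (xM j) => /ltW.
by move=> j _; apply: leif_eq; case/andP: (xM j).
Qed.

Lemma edge_equations_total (R : realType) n k (G : hypergraph n k.+1)
    (rho : R) (x : 'cV[R]_n) :
  edge_equations G rho x ->
  rho * \sum_(i < n) x i 0 ^+ k.+1 =
    (\sum_(e in edges G) \prod_(j in e) x j 0) *+ k.+1.
Proof.
move=> eqx; rewrite -handshake mulr_sumr; apply: eq_bigr => i _.
rewrite exprS mulrCA eqx mulr_sumr; apply: eq_bigr => e /andP[_ ie].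
by rewrite [RHS](big_setD1 i).
Qed.

(** The equation at a minimal entry bounds the common degree by [rho]; so at an
    entry equal to the upper bound [M], the sum over the star of [i] reaches its
    upper bound, and each entry occurring in it is [M]. *)
Lemma regular_max_closed (R : realType) n k (G : hypergraph n k.+1)
    (rho M : R) (x : 'cV[R]_n) :
  regular G -> edge_equations G rho x -> (forall j, 0 < x j 0 <= M) ->
  forall e i j, e \in edges G -> i \in e -> j \in e -> x i 0 = M -> x j 0 = M.
Proof.
move=> reg eqx xM e i j eG ie je xiM.
have M0 : 0 < M by case/andP: (xM i) => /lt_le_trans; apply.
have [m _ mP] := @Order.TotalTheory.arg_minP _ _ _ i predT (fun j => x j 0) isT.
have xm0 : 0 < x m 0 by case/andP: (xM m).
pose S := [set f in edges G | i \in f].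
have degi : degree G i = #|S| by [].
have card_star l f : f \in edges G -> l \in f -> #|f :\ l| = k.
  by move=> fG lf; have := edges_uniform fG; rewrite (cardsD1 l) lf => -[].
have deg_le : (degree G i)%:R <= rho.
  rewrite -(ler_pM2r (exprn_gt0 k xm0)) eqx (reg i m) mulr_natl -sumr_star_const.
  apply: ler_sum => f /andP[fG mf].
  rewrite -(card_star m f) // -prodr_const; apply: ler_prod => l _.
  by rewrite ltW // mP.
have := @leif_sum_prod R _ S (fun f => f :\ i) k (fun l => x l 0) M xM M0.
case=> [f|sum_le sum_eq]; first by rewrite inE => /andP[]; apply: card_star.
have sumE : \sum_(f in S) \prod_(l in f :\ i) x l 0 = rho * M ^+ k.
  by rewrite -xiM eqx; apply: eq_bigl => f; rewrite inE.
(* The sum is [rho * M^k], which [deg_le] puts above [degree * M^k]. *)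
move: sum_eq; rewrite eq_le sum_le sumE /= -mulr_natl ler_pM2r ?exprn_gt0 //.
rewrite -degi deg_le => /esym /forallP/(_ e); rewrite inE eG ie /=.
have [-> //|ji] := eqVneq j i.
by move=> /forallP/(_ j); rewrite !inE ji je => /eqP.
Qed.

Lemma max_entryP (R : realType) n (x : 'cV[R]_n) (i : 'I_n) :
  (forall j, 0 < x j 0) ->
  (forall j, 0 < x j 0 <= max_entry x) /\ exists j, x j 0 = max_entry x.
Proof.
move=> x0; split=> [j|]; first by rewrite x0; exact: (le_bigmax 0 (fun j => x j 0)).
have [//|j _|j _ maxj] := @eq_bigmax _ _ _ 0 i predT (fun j => x j 0).
  exact: ltW.
by exists j; rewrite -maxj.
Qed.

(** * The bound on the maximum entry *)

Theorem theorem2p3 (R : realType) (n k : nat) (G : hypergraph n k)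
    (rho : R) (x : 'cV[R]_n) :
  (2 <= k)%N ->
  hconnected G ->
  (1 <= #|edges G|)%N ->
  is_spectral_radius G rho ->
  is_principal_eigenvector G x ->
  (rho / (k * #|edges G|)%:R) `^ (k%:R^-1) <= max_entry x /\
  (max_entry x = (rho / (k * #|edges G|)%:R) `^ (k%:R^-1) <-> regular G).
Proof.
case: k G => [//|k] G k2 conn m0 srho [rho' [srho' eig x0 norm]].
have {srho srho'} <- := spectral_radius_unique srho' srho.
have eqx : edge_equations G rho' x by exact: eigenpair_edge_equations.
move: rho' eqx {eig} => {}rho eqx.
have covered i := connected_covered i k2 conn m0.
have /card_gt0P[e eG] := m0.
have /card_gt0P[i0 _] : (0 < #|e|)%N by rewrite (edges_uniform eG).
have [xM [u xu]] := max_entryP i0 x0.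
set M := max_entry x in xM xu *.
have M0 : 0 < M by rewrite -xu.
(* [E] is [rho / k.+1], so the right-hand side [y] of the bound is the [k.+1]-th
   root of [E / m], with [m] the number of edges; [M] and [y] are compared
   through their [k.+1]-th powers. *)
set E := \sum_(e in edges G) \prod_(j in e) x j 0.
have rhoE : rho = E *+ k.+1 by rewrite /E -(edge_equations_total eqx) norm mulr1.
have E0 : 0 <= E by apply: sumr_ge0 => f _; apply: prodr_ge0 => j _; apply: ltW.
have [E_le E_eq] := @leif_sum_prod R _ (edges G) id k.+1 (fun j => x j 0) M xM M0
  (fun f fG => edges_uniform fG).
rewrite -/E in E_le E_eq.
have mR : 0 < #|edges G|%:R :> R by rewrite ltr0n.
set y := _ `^ _.
have y0 : 0 <= y by apply: powR_ge0.
have yk : y ^+ k.+1 = E / #|edges G|%:R.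
  rewrite /y -powR_mulrn ?powR_ge0 // -powRrM mulVf ?pnatr_eq0 // powRr1.
    by rewrite rhoE -mulr_natr natrM invfM mulrA mulfK // pnatr_eq0.
  by rewrite rhoE divr_ge0 // mulrn_wge0.
have E_eqy : (M == y) = [forall e in edges G, [forall j in e, x j 0 == M]].
  have mN0 := lt0r_neq0 mR.
  rewrite -E_eq -(eqrXn2 (ltn0Sn k) (ltW M0) y0) yk eq_sym.
  rewrite -[X in _ == X](mulfK mN0) (inj_eq (mulIf (invr_neq0 mN0))).
  by rewrite mulr_natr.
split.
  rewrite -(@ler_pXn2r _ k.+1) ?nnegrE ?(ltW M0) // yk.
  by rewrite ler_pdivrMr // mulr_natr.
split=> [/eqP|reg].
  rewrite E_eqy => /forallP all_max.
  have xconst i : x i 0 = M.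
    have [f fG fi] := covered i.
    by have := all_max f; rewrite fG => /forallP/(_ i); rewrite fi => /eqP.
  have deg_rho i : (degree G i)%:R = rho.
    apply: (@mulIf _ (M ^+ k)); first by rewrite expf_neq0 // gt_eqF.
    rewrite -{2}(xconst i) eqx mulr_natl -sumr_star_const.
    apply: eq_bigr => f /andP[fG fi].
    rewrite (eq_bigr (fun=> M)) // prodr_const; congr (_ ^+ _).
    by have := edges_uniform fG; rewrite (cardsD1 i) fi => -[].
  by move=> i j; apply/eqP; rewrite -(eqr_nat R) !deg_rho.
apply/eqP; rewrite E_eqy.
have xmax : forall i, x i 0 == M.
  apply: (@connected_invariant _ _ G (fun i => x i 0 == M) u conn); last exact/eqP.
  move=> f i j fG fi fj /eqP xi; apply/eqP.
  exact: (regular_max_closed reg eqx xM fG fi fj xi).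
by apply/forallP => f; apply/implyP => _; apply/forallP => j; rewrite xmax implybT.
Qed.
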